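(* For $b\notin\{0,-1,-2,\ldots\}$ and $x\in\mathbb{R}$, $$H^{(1)}\!\left(\left.\begin{array}{c}1\\ b\end{array}\right|x\right)=-\frac{x\,e^{x}}{b^2}\;{}_2F_2\!\left(\left.\begin{array}{c}b,b\\ b+1,b+1\end{array}\right|-x\right).$$
   Context: $H^{(1)}\!\left(\left.\begin{array}{c}a\\ b\end{array}\right|x\right)=\frac{\partial}{\partial b}\left[{}_1F_1(a;b;x)\right]$ is the derivative of the Kummer confluent hypergeometric function with respect to its second parameter; ${}_2F_2$ is the generalized hypergeometric function. *)

(* Defs.v *)
From Stdlib Require Import Reals List Factorial.
From Coquelicot Require Import Coquelicot.
Import ListNotations.

Open Scope C_scope.

(* Rising factorial (a)_n = a (a+1) ... (a+n-1). *)
Fixpoint pochhammer (a : C) (n : nat) : C :=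
  match n with
  | O => 1
  | S m => pochhammer a m * (a + INR m)
  end.

Definition pochhammer_list (l : list C) (n : nat) : C :=
  fold_right Cmult (RtoC 1) (map (fun a => pochhammer a n) l).

Definition pFq_term (l m : list C) (z : C) (n : nat) : C :=
  pochhammer_list l n / pochhammer_list m n * (z ^ n / INR (fact n)).

(* Like [Series], this is total, and is the sum only of a convergent series. *)
Definition CSeries (u : nat -> C) : C :=
  (Series (fun n => Re (u n)), Series (fun n => Im (u n))).

(* [l] lists the upper parameters and [m] the lower ones; no lower parameter
   may be a nonpositive integer. *)
Definition pFq (l m : list C) (z : C) : C := CSeries (pFq_term l m z).

Definition kummer1F1 (a b z : C) : C := pFq [a] [b] z.

Definition hyp2F2 (a1 a2 b1 b2 z : C) : C := pFq [a1; a2] [b1; b2] z.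

(* The second parameter is complex, and differentiation in it is complex
   differentiation.  [C_derive] is a meaningful value only where the function
   is differentiable, so it should be accompanied by [ex_derive]. *)
Definition kummerH1 (a b z : C) : C := C_derive (fun c => kummer1F1 a c z) b.

(* Main.v *)
(* With G_j(c) = sum_n (-x)^n / (n! (c+n)^j), the recurrence
   c G_1(c) = e^(-x) + x G_1(c+1) iterates to
   x e^x G_1(c) = sum_(1 <= k <= n) x^k / (c)_k + x e^x x^n / (c)_n G_1(c+n),
   whose last term tends to 0, so that 1F1(1;c;x) = 1 + x e^x G_1(c).  A
   quadratic bound on the Taylor remainder, uniform in n, gives G_1' = - G_2,
   and (b)_n / (b+1)_n = b / (b+n) identifies b^2 G_2(b) as the 2F2 series. *)
Require Import Defs.
From Stdlib Require Import Reals List Factorial Lra Lia.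
From Coquelicot Require Import Coquelicot.

Open Scope C_scope.

(** * Complex series and real majorants *)

Lemma CSeries_unique (u : nat -> C) (l : C) :
  @is_series C_AbsRing C_NormedModule u l -> CSeries u = l.
Proof.
  intros Hu.
  assert (Hre : forall n, Re (@sum_n C_AbsRing u n) =
    @sum_n R_AbelianMonoid (fun k => Re (u k)) n).
  { induction n as [|n IH]; [now rewrite !sum_O|].
    rewrite !sum_Sn, <- IH; reflexivity. }
  assert (Him : forall n, Im (@sum_n C_AbsRing u n) =
    @sum_n R_AbelianMonoid (fun k => Im (u k)) n).
  { induction n as [|n IH]; [now rewrite !sum_O|].
    rewrite !sum_Sn, <- IH; reflexivity. }
  rewrite (surjective_pairing l); unfold CSeries; f_equal.
  - apply is_series_unique, (filterlim_ext _ _ Hre).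
    eapply filterlim_comp; [exact Hu|].
    (* Balls of [C] are products of coordinate balls, so a neighbourhood of [Re l] pulls back to a
       neighbourhood of [l]. *)
    intros P [eps HP]; exists eps; intros z [Hz _]; exact (HP _ Hz).
  - apply is_series_unique, (filterlim_ext _ _ Him).
    eapply filterlim_comp; [exact Hu|].
    intros P [eps HP]; exists eps; intros z [_ Hz]; exact (HP _ Hz).
Qed.

Lemma is_series_CSeries_le (u : nat -> C) (e : nat -> R) :
  (forall n, (Cmod (u n) <= e n)%R) -> ex_series e ->
  @is_series C_AbsRing C_NormedModule u (CSeries u).
Proof.
  intros Hle He.
  destruct (@ex_series_le C_AbsRing C_CompleteNormedModule u e Hle He) as [l Hl].
  rewrite (CSeries_unique u l Hl); exact Hl.
Qed.

(** The triangle inequality gives the bound on partial sums, and it survives the limit because the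
    norm is continuous. *)
Lemma is_series_Cmod_le (u : nat -> C) (e : nat -> R) (l : C) (s : R) :
  (forall n, (Cmod (u n) <= e n)%R) ->
  @is_series C_AbsRing C_NormedModule u l -> is_series e s -> (Cmod l <= s)%R.
Proof.
  intros Hle Hu He.
  assert (Hn : forall n, (Cmod (@sum_n C_AbsRing u n) <= @sum_n R_AbelianMonoid e n)%R).
  { induction n as [|n IH]; [rewrite !sum_O; apply Hle|].
    rewrite !sum_Sn.
    eapply Rle_trans; [apply Cmod_triangle|].
    apply Rplus_le_compat; auto. }
  apply (is_lim_seq_le _ _ (Finite (Cmod l)) (Finite s) Hn); [|exact He].
  exact (filterlim_comp _ _ _ _ _ _ _ _ Hu
           (@filterlim_norm C_AbsRing C_NormedModule l)).
Qed.

Lemma RtoC_series (e : nat -> R) (s : R) :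
  is_series e s -> @is_series C_AbsRing C_NormedModule (fun n => RtoC (e n)) (RtoC s).
Proof.
  intros He.
  assert (Hs : forall n, RtoC (@sum_n R_AbelianMonoid e n) =
    @sum_n C_AbsRing (fun k => RtoC (e k)) n).
  { induction n as [|n IH]; [now rewrite !sum_O|].
    rewrite !sum_Sn, <- IH; apply RtoC_plus. }
  apply (filterlim_ext _ _ Hs).
  eapply filterlim_comp; [exact He|].
  intros P [eps HP]; exists eps; intros z Hz; apply HP; split; [exact Hz|].
  apply ball_center.
Qed.

Lemma is_series_exp (y : R) :
  is_series (fun n => y ^ n / INR (fact n))%R (exp y).
Proof.
  generalize (proj1 (is_pseries_R _ _ _) (is_exp_Reals y)).
  apply is_series_ext; intros n; unfold Rdiv; apply Rmult_comm.
Qed.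

Lemma Rabs_exp_term (y : R) (n : nat) :
  Rabs (y ^ n / INR (fact n)) = (Rabs y ^ n / INR (fact n))%R.
Proof.
  assert (H := INR_fact_lt_0 n).
  unfold Rdiv; rewrite Rabs_mult, RPow_abs, (Rabs_right (/ _)); auto.
  apply Rle_ge, Rlt_le, Rinv_0_lt_compat, H.
Qed.

(** * Parameters away from the nonpositive integers *)

Definition not_nonpos_int (c : C) : Prop := forall k : nat, c + INR k <> 0.

Lemma not_nonpos_int_shift (c : C) (n : nat) :
  not_nonpos_int c -> not_nonpos_int (c + INR n).
Proof.
  intros Hc k; rewrite <- Cplus_assoc, <- RtoC_plus, <- plus_INR; apply Hc.
Qed.

(** Once n >= |c| + 1, |c + n| >= n - |c| >= 1; the finitely many earlier n have a positive minimum.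
    One d for all n is what makes the later estimates uniform in n. *)
Lemma not_nonpos_int_separated (c : C) :
  not_nonpos_int c ->
  exists d : R, (0 < d)%R /\ forall n : nat, (d <= Cmod (c + INR n))%R.
Proof.
  intros Hc.
  assert (Hfin : forall N : nat, exists d : R, (0 < d)%R /\
            forall n : nat, (n < N)%nat -> (d <= Cmod (c + INR n))%R).
  { induction N as [|N [d [Hd HN]]].
    - exists 1%R; split; [lra | lia].
    - exists (Rmin d (Cmod (c + INR N))); split.
      + apply Rmin_pos; [exact Hd | apply Cmod_gt_0, Hc].
      + intros n Hn. destruct (Nat.eq_dec n N) as [->|HnN]; [apply Rmin_r|].
        eapply Rle_trans; [apply Rmin_l | apply HN; lia]. }
  destruct (INR_unbounded (Cmod c + 1)) as [N HN].
  destruct (Hfin N) as [d [Hd Hlt]].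
  exists (Rmin d 1); split; [apply Rmin_pos; lra|]; intros n.
  destruct (Nat.lt_ge_cases n N) as [Hn|Hn].
  - eapply Rle_trans; [apply Rmin_l | auto].
  - eapply Rle_trans; [apply Rmin_r|].
    apply le_INR in Hn.
    assert (H := Cmod_triangle (c + INR n) (- c)).
    replace (c + INR n + - c) with (RtoC (INR n)) in H by ring.
    rewrite Cmod_opp, Cmod_R, Rabs_right in H; [lra|].
    apply Rle_ge, pos_INR.
Qed.

(** * The series G_j and its recurrence *)

Definition exp_cauchy_term (j : nat) (y : R) (c : C) (n : nat) : C :=
  RtoC (y ^ n / INR (fact n)) / (c + INR n) ^ j.

(** This is G_j(c) at y = -x. For j = 1 and Re c > 0 it equals the integral of t^(c-1) e^(y t) over
    [0,1], a form of the lower incomplete gamma function. *)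
Definition exp_cauchy (j : nat) (y : R) (c : C) : C :=
  CSeries (exp_cauchy_term j y c).

Lemma exp_cauchy_term_le (j : nat) (y d : R) (c : C) (n : nat) :
  (0 < d)%R -> (d <= Cmod (c + INR n))%R ->
  (Cmod (exp_cauchy_term j y c n) <= / d ^ j * (Rabs y ^ n / INR (fact n)))%R.
Proof.
  intros Hd Hn; unfold exp_cauchy_term.
  assert (Hz : c + INR n <> 0) by (apply Cmod_gt_0; lra).
  rewrite Cmod_div by (apply Cpow_nz, Hz).
  rewrite Cmod_R, Rabs_exp_term, Cmod_pow; unfold Rdiv at 1.
  rewrite Rmult_comm; apply Rmult_le_compat_r.
  - rewrite <- Rabs_exp_term; apply Rabs_pos.
  - apply Rinv_le_contravar; [now apply pow_lt | apply pow_incr; lra].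
Qed.

Lemma exp_cauchy_majorant (y a : R) :
  is_series (fun n => a * (Rabs y ^ n / INR (fact n)))%R (a * exp (Rabs y))%R.
Proof.
  exact (is_series_scal a _ _ (is_series_exp (Rabs y))).
Qed.

Lemma is_series_exp_cauchy (j : nat) (y : R) (c : C) :
  not_nonpos_int c ->
  @is_series C_AbsRing C_NormedModule (exp_cauchy_term j y c) (exp_cauchy j y c).
Proof.
  intros Hc; destruct (not_nonpos_int_separated c Hc) as [d [Hd Hn]].
  eapply is_series_CSeries_le.
  - intros n; apply exp_cauchy_term_le; [exact Hd | apply Hn].
  - eexists; apply exp_cauchy_majorant.
Qed.

Lemma Cmod_exp_cauchy_le (j : nat) (y d : R) (c : C) :
  (0 < d)%R -> (forall n : nat, (d <= Cmod (c + INR n))%R) ->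
  (Cmod (exp_cauchy j y c) <= / d ^ j * exp (Rabs y))%R.
Proof.
  intros Hd Hn.
  eapply is_series_Cmod_le; [|apply is_series_exp_cauchy|apply exp_cauchy_majorant].
  - intros n; apply exp_cauchy_term_le; [exact Hd | apply Hn].
  - intros n; apply Cmod_gt_0; specialize (Hn n); lra.
Qed.

(* c / (c + n) = 1 - n / (c + n) and n / n! = 1 / (n - 1)!. *)
Lemma exp_cauchy_term_shift (y : R) (c : C) (n : nat) :
  not_nonpos_int c ->
  RtoC (y ^ S n / INR (fact (S n))) - c * exp_cauchy_term 1 y c (S n) =
  RtoC y * exp_cauchy_term 1 y (c + 1) n.
Proof.
  intros Hc; assert (H := Hc (S n)).
  assert (Hf : INR (fact n) <> 0%R) by apply INR_fact_neq_0.
  assert (HS : INR (S n) <> 0%R) by (apply not_0_INR; lia).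
  unfold exp_cauchy_term.
  rewrite !Cpow_1_r.
  replace (y ^ S n / INR (fact (S n)))%R
    with (y * (y ^ n / INR (fact n)) / INR (S n))%R
    by (rewrite fact_simpl, mult_INR; simpl pow; field; auto).
  rewrite (RtoC_div _ _ HS), RtoC_mult.
  replace (c + 1 + INR n) with (c + INR (S n))
    by (rewrite S_INR, RtoC_plus; ring).
  field; split; [exact H | intros E; apply HS; now apply RtoC_inj].
Qed.

(** Subtract c G_1(c) from the exponential series term by term: the term of index 0 vanishes, and
    the others, moved down by one index, form y times the series at c + 1. *)
Lemma exp_cauchy_shift (y : R) (c : C) :
  not_nonpos_int c ->
  c * exp_cauchy 1 y c = RtoC (exp y) - RtoC y * exp_cauchy 1 y (c + 1).
Proof.
  intros Hc.
  assert (Hc1 : not_nonpos_int (c + 1)) by exact (not_nonpos_int_shift c 1 Hc).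
  assert (H1 : @is_series C_AbsRing C_NormedModule
    (fun n => RtoC (y ^ n / INR (fact n)) - c * exp_cauchy_term 1 y c n)
    (RtoC (exp y) - c * exp_cauchy 1 y c)).
  { apply (@is_series_minus C_AbsRing C_NormedModule).
    - exact (RtoC_series _ _ (is_series_exp y)).
    - exact (@is_series_scal C_AbsRing C_NormedModule c _ _
               (is_series_exp_cauchy 1 y c Hc)). }
  assert (H2 : @is_series C_AbsRing C_NormedModule
    (fun n => RtoC y * exp_cauchy_term 1 y (c + 1) n)
    (RtoC (exp y) - c * exp_cauchy 1 y c)).
  { eapply is_series_ext;
      [intros n; exact (exp_cauchy_term_shift y c n Hc)|].
    apply (@is_series_incr_1 C_AbsRing C_NormedModule
      (fun n => RtoC (y ^ n / INR (fact n)) - c * exp_cauchy_term 1 y c n)).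
    (* The term of index 0 is 1 - c / c, so dropping it leaves the sum unchanged. *)
    assert (H0 : RtoC (y ^ 0 / INR (fact 0)) - c * exp_cauchy_term 1 y c 0 = 0).
    { assert (Hc0 := Hc O); unfold exp_cauchy_term; simpl in *.
      rewrite Cplus_0_r in Hc0; rewrite Rdiv_1_r; field; exact Hc0. }
    rewrite H0; change (@plus C_AbelianMonoid) with Cplus.
    match goal with |- is_series _ ?l =>
      replace l with (RtoC (exp y) - c * exp_cauchy 1 y c)
        by (symmetry; apply Cplus_0_r) end.
    exact H1. }
  (* The same series now has the sums e^y - c G_1(c) and y G_1(c + 1); uniqueness equates them. *)
  transitivity (RtoC (exp y) - (RtoC (exp y) - c * exp_cauchy 1 y c)); [ring|].
  apply (f_equal (Cminus (exp y))).
  rewrite <- (CSeries_unique _ _ H2); apply CSeries_unique.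
  exact (@is_series_scal C_AbsRing C_NormedModule (RtoC y) _ _
           (is_series_exp_cauchy 1 y (c + 1) Hc1)).
Qed.

(** * Rising factorials *)

Lemma pochhammer_neq_0 (c : C) (n : nat) :
  not_nonpos_int c -> pochhammer c n <> 0.
Proof.
  intros Hc; induction n as [|n IH]; simpl.
  - intros E; apply RtoC_inj in E; lra.
  - apply Cmult_neq_0; [exact IH | apply Hc].
Qed.

Lemma pochhammer_1 (n : nat) : pochhammer 1 n = RtoC (INR (fact n)).
Proof.
  induction n as [|n IH]; [reflexivity|].
  rewrite fact_simpl, mult_INR, S_INR, RtoC_mult, RtoC_plus, <- IH.
  simpl; ring.
Qed.

(** Both sides are (c)_(n+1), with the first or the last factor split off. *)
Lemma pochhammer_shift (c : C) (n : nat) :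
  c * pochhammer (c + 1) n = pochhammer c n * (c + INR n).
Proof.
  induction n as [|n IH]; [simpl; ring|].
  cbn [pochhammer].
  rewrite Cmult_assoc, IH, S_INR, RtoC_plus; ring.
Qed.

(** Consecutive terms have ratio |x| / |c + n|. Once n >= |c| + 2|x|, |c + n| >= 2|x| and the ratio
    is at most 1/2, so the tail is dominated by a geometric sequence. *)
Lemma pow_div_pochhammer_lim (c : C) (x : R) :
  not_nonpos_int c ->
  is_lim_seq (fun n => Cmod (RtoC x ^ n / pochhammer c n)) 0%R.
Proof.
  intros Hc.
  destruct (INR_unbounded (Cmod c + 2 * Rabs x)) as [N HN].
  set (p := fun n => Cmod (RtoC x ^ n / pochhammer c n)).
  assert (Hstep : forall n, (N <= n)%nat -> (p (S n) <= / 2 * p n)%R).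
  { intros n Hn; unfold p; cbn [pochhammer].
    assert (Hp := pochhammer_neq_0 c n Hc).
    replace (RtoC x ^ S n / (pochhammer c n * (c + INR n)))
      with (RtoC x / (c + INR n) * (RtoC x ^ n / pochhammer c n))
      by (rewrite Cpow_S; field; split; [apply Hc | apply Hp]).
    rewrite Cmod_mult; apply Rmult_le_compat_r; [apply Cmod_ge_0|].
    rewrite Cmod_div, Cmod_R by apply Hc.
    apply le_INR in Hn.
    assert (H := Cmod_triangle (c + INR n) (- c)).
    replace (c + INR n + - c) with (RtoC (INR n)) in H by ring.
    rewrite Cmod_opp, Cmod_R, (Rabs_right (INR n)) in H
      by apply Rle_ge, pos_INR.
    assert (H0 := proj1 (Cmod_gt_0 _) (Hc n)).
    apply (Rmult_le_reg_r (Cmod (c + INR n))); [exact H0|].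
    unfold Rdiv; rewrite Rmult_assoc, Rinv_l by lra; lra. }
  assert (Hgeom : forall k, (p (k + N)%nat <= (/ 2) ^ k * p N)%R).
  { induction k as [|k IH]; [simpl; lra|].
    eapply Rle_trans; [apply (Hstep (k + N)%nat); lia|].
    simpl pow; lra. }
  apply (is_lim_seq_incr_n p N).
  apply (is_lim_seq_le_le (fun _ => 0%R) _ (fun k => (/ 2) ^ k * p N)%R).
  - intros k; split; [apply Cmod_ge_0 | apply Hgeom].
  - apply is_lim_seq_const.
  - replace (Finite 0) with (Rbar_mult 0%R (p N)) by (simpl; f_equal; ring).
    apply is_lim_seq_scal_r, is_lim_seq_geom.
    rewrite Rabs_right; lra.
Qed.

(** * Closed form of 1F1(1;c;x) *)

Lemma pFq_term_1F1_1 (c z : C) (n : nat) :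
  not_nonpos_int c -> pFq_term (RtoC 1 :: nil) (c :: nil) z n = z ^ n / pochhammer c n.
Proof.
  intros Hc; unfold pFq_term, pochhammer_list; simpl.
  rewrite pochhammer_1.
  assert (Hp := pochhammer_neq_0 c n Hc).
  field; split; [exact Hp|].
  intros E; apply RtoC_inj in E; now apply (INR_fact_neq_0 n).
Qed.

(** Induction on n, each step using the recurrence at c + n. As [sum_n] runs over indices 0 to n,
    the remainder carries x^n / (c)_n, and at n = 0 the partial sum 1 cancels the leading 1. *)
Lemma kummer1F1_1_remainder (c : C) (x : R) (n : nat) :
  not_nonpos_int c ->
  1 + RtoC x * RtoC (exp x) * exp_cauchy 1 (- x) c
    - @sum_n C_AbsRing (pFq_term (RtoC 1 :: nil) (c :: nil) x) n =
  RtoC x * RtoC (exp x) * (RtoC x ^ n / pochhammer c n)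
    * exp_cauchy 1 (- x) (c + INR n).
Proof.
  intros Hc; induction n as [|n IH].
  - rewrite sum_O, pFq_term_1F1_1 by exact Hc; simpl.
    rewrite Cplus_0_r; field.
  - rewrite sum_Sn, pFq_term_1F1_1 by exact Hc.
    change (@plus (AbsRing.AbelianMonoid C_AbsRing)) with Cplus.
    assert (Hp := pochhammer_neq_0 c n Hc).
    assert (Hn := Hc n).
    assert (Hshift := exp_cauchy_shift (- x) (c + INR n)
                        (not_nonpos_int_shift c n Hc)).
    assert (He : RtoC (exp x) * RtoC (exp (- x)) = 1).
    { rewrite <- RtoC_mult, <- exp_plus, Rplus_opp_r, exp_0; reflexivity. }
    rewrite RtoC_opp in Hshift.
    rewrite S_INR, RtoC_plus, Cplus_assoc.
    cbn [pochhammer]; rewrite Cpow_S.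
    match goal with |- ?a - Cplus ?s ?t = _ =>
      replace (a - Cplus s t) with ((a - s) - t) by ring end.
    rewrite IH.
    set (G := exp_cauchy 1 (- x) (c + INR n)) in *.
    set (G' := exp_cauchy 1 (- x) (c + INR n + 1)) in *.
    (* Factor out x^(n+1) / (c)_(n+1). The newly subtracted term is this factor times 1 = e^x
       e^(-x), so the recurrence turns the bracket into e^x x G'. *)
    transitivity (RtoC x * RtoC x ^ n / (pochhammer c n * (c + INR n)) *
      (RtoC (exp x) * ((c + INR n) * G) - RtoC (exp x) * RtoC (exp (- x)))).
    { rewrite He; field; split; [exact Hn | exact Hp]. }
    rewrite Hshift; field; split; [exact Hn | exact Hp].
Qed.

(** Convergence and the value come together: the remainder is at most a constant times |x^n /
    (c)_n|, which tends to 0. *)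
Lemma kummer1F1_1 (c : C) (x : R) :
  not_nonpos_int c ->
  kummer1F1 1 c x = 1 + RtoC x * RtoC (exp x) * exp_cauchy 1 (- x) c.
Proof.
  intros Hc.
  destruct (not_nonpos_int_separated c Hc) as [d [Hd Hn]].
  apply CSeries_unique.
  set (F := 1 + RtoC x * RtoC (exp x) * exp_cauchy 1 (- x) c).
  (* [K] bounds |x e^x G_1(c + n)| for every n at once: the separation d of c also serves each shift
     c + n, since c + n + k is again of the form c + m. *)
  set (K := (Cmod (RtoC x * RtoC (exp x)) * (/ d ^ 1 * exp (Rabs (- x))))%R).
  assert (Hlim : is_lim_seq
    (fun n => Cmod (F - @sum_n C_AbsRing (pFq_term (RtoC 1 :: nil) (c :: nil) x) n)) 0%R).
  { apply (is_lim_seq_le_le (fun _ => 0%R) _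
             (fun n => K * Cmod (RtoC x ^ n / pochhammer c n))%R).
    - intros n; split; [apply Cmod_ge_0|].
      unfold F; rewrite (kummer1F1_1_remainder c x n Hc), !Cmod_mult.
      unfold K; rewrite Cmod_mult, (Rmult_assoc _ (/ d ^ 1 * _)%R).
      rewrite (Rmult_comm (/ d ^ 1 * _)%R), <- Rmult_assoc.
      apply Rmult_le_compat_l.
      + repeat apply Rmult_le_pos; apply Cmod_ge_0.
      + apply Cmod_exp_cauchy_le; [exact Hd|].
        intros k; rewrite <- Cplus_assoc, <- RtoC_plus, <- plus_INR; apply Hn.
    - apply is_lim_seq_const.
    - replace (Finite 0) with (Rbar_mult K 0%R) by (simpl; f_equal; ring).
      apply is_lim_seq_scal_l, pow_div_pochhammer_lim, Hc. }
  apply (@filterlim_locally_ball_norm C_AbsRing nat C_NormedModule);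
    [apply eventually_filter|].
  intros eps.
  apply is_lim_seq_spec in Hlim; destruct (Hlim eps) as [N HN].
  exists N; intros n Hle; specialize (HN n Hle).
  rewrite Rminus_0_r, Rabs_right in HN by apply Rle_ge, Cmod_ge_0.
  change (Cmod (@sum_n C_AbsRing (pFq_term (RtoC 1 :: nil) (c :: nil) x) n - F) < eps)%R.
  now rewrite <- Cmod_opp, Copp_minus_distr.
Qed.

(** * Complex differentiation in the second parameter *)

Lemma is_derive_quadratic_remainder (f : C -> C) (b l : C) (d M : R) :
  (0 < d)%R ->
  (forall h : C, (Cmod h < d)%R ->
     (Cmod (f (b + h)%C - f b - h * l) <= M * Cmod h ^ 2)%R) ->
  @is_derive C_AbsRing C_NormedModule f b l.
Proof.
  intros Hd Hf; split.
  { apply (@is_linear_scal_l C_AbsRing C_NormedModule). }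
  (* The domination clause of [is_derive] quantifies over limit points of the neighbourhood filter
     of b; the only one is b. *)
  intros x Hx.
  apply (@is_filter_lim_locally_unique C_AbsRing (AbsRing_NormedModule C_AbsRing))
    in Hx; subst x.
  intros eps.
  apply (@locally_le_locally_norm C_AbsRing (AbsRing_NormedModule C_AbsRing)).
  (* The sign of M is free, so [Rabs M + 1] serves as a positive divisor. From |h| (|M| + 1) <= eps
     follows M |h|^2 <= eps |h|. *)
  assert (HM : (0 < Rabs M + 1)%R) by (assert (H := Rabs_pos M); lra).
  assert (Hr : (0 < Rmin d (eps / (Rabs M + 1)))%R).
  { apply Rmin_pos; [exact Hd|]; apply Rdiv_lt_0_compat; [apply cond_pos | exact HM]. }
  exists (mkposreal _ Hr); intros y Hy.
  change (Cmod (y - b) < Rmin d (eps / (Rabs M + 1)))%R in Hy.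
  change (Cmod (f y - f b - (y - b) * l) <= eps * Cmod (y - b))%R.
  set (h := y - b) in *.
  replace y with (b + h) by (unfold h; ring).
  eapply Rle_trans; [apply Hf; eapply Rlt_le_trans; [exact Hy | apply Rmin_l]|].
  assert (Hh := Cmod_ge_0 h).
  rewrite <- Rsqr_pow2; unfold Rsqr; rewrite <- Rmult_assoc.
  apply Rmult_le_compat_r; [exact Hh|].
  assert (Hb : (Cmod h * (Rabs M + 1) <= eps)%R).
  { assert (H : (Cmod h <= eps / (Rabs M + 1))%R)
      by (eapply Rle_trans; [apply Rlt_le, Hy | apply Rmin_r]).
    apply (Rmult_le_compat_r (Rabs M + 1)) in H; [|lra].
    unfold Rdiv in H; rewrite Rmult_assoc, Rinv_l in H; lra. }
  assert (H := Rle_abs M); nra.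
Qed.

(** With z = b + n, 1/(z+h) - 1/z + h/z^2 = h^2 / (z^2 (z+h)). Since |z| >= 2d and |h| < d, |z+h| >=
    d, so the denominator has modulus at least d^3 for every n, and the bound sums against the
    exponential series. *)
Lemma exp_cauchy_quadratic_remainder (y d : R) (b h : C) :
  (0 < d)%R -> (forall n : nat, (2 * d <= Cmod (b + INR n))%R) ->
  (Cmod h < d)%R ->
  (Cmod (exp_cauchy 1 y (b + h) - exp_cauchy 1 y b + h * exp_cauchy 2 y b)
   <= / d ^ 3 * exp (Rabs y) * Cmod h ^ 2)%R.
Proof.
  intros Hd Hb Hh.
  assert (Hbh : forall n : nat, (d <= Cmod (b + h + INR n))%R).
  { intros n.
    assert (H := Cmod_triangle (b + h + INR n) (- h)).
    replace (b + h + INR n + - h) with (b + INR n) in H by ring.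
    rewrite Cmod_opp in H; specialize (Hb n); lra. }
  assert (Nb : not_nonpos_int b)
    by (intros n; apply Cmod_gt_0; specialize (Hb n); lra).
  assert (Nbh : not_nonpos_int (b + h))
    by (intros n; apply Cmod_gt_0; specialize (Hbh n); lra).
  apply (is_series_Cmod_le
    (fun n => exp_cauchy_term 1 y (b + h) n - exp_cauchy_term 1 y b n
              + h * exp_cauchy_term 2 y b n)
    (fun n => / d ^ 3 * Cmod h ^ 2 * (Rabs y ^ n / INR (fact n)))%R).
  - intros n.
    replace (exp_cauchy_term 1 y (b + h) n - exp_cauchy_term 1 y b n
              + h * exp_cauchy_term 2 y b n)
      with (RtoC (y ^ n / INR (fact n)) *
            (h ^ 2 / ((b + INR n) ^ 2 * (b + h + INR n))))
      by (unfold exp_cauchy_term; simpl; field; split; [apply Nb | apply Nbh]).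
    rewrite Cmod_mult, Cmod_R, Rabs_exp_term, Rmult_comm.
    apply Rmult_le_compat_r; [rewrite <- Rabs_exp_term; apply Rabs_pos|].
    rewrite Cmod_div, Cmod_mult, !Cmod_pow
      by (apply Cmult_neq_0; [apply Cpow_nz, Nb | apply Nbh]).
    unfold Rdiv; rewrite Rmult_comm.
    apply Rmult_le_compat_r; [apply pow_le, Cmod_ge_0|].
    apply Rinv_le_contravar; [now apply pow_lt|].
    specialize (Hb n); specialize (Hbh n).
    replace (d ^ 3)%R with (d ^ 2 * d)%R by ring.
    apply Rmult_le_compat; [apply pow_le | | apply pow_incr |]; lra.
  - apply (@is_series_plus C_AbsRing C_NormedModule);
      [apply (@is_series_minus C_AbsRing C_NormedModule)|].
    + exact (is_series_exp_cauchy 1 y (b + h) Nbh).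
    + exact (is_series_exp_cauchy 1 y b Nb).
    + exact (@is_series_scal C_AbsRing C_NormedModule h _ _
               (is_series_exp_cauchy 2 y b Nb)).
  - replace (/ d ^ 3 * exp (Rabs y) * Cmod h ^ 2)%R
      with (/ d ^ 3 * Cmod h ^ 2 * exp (Rabs y))%R by ring.
    apply exp_cauchy_majorant.
Qed.

Lemma is_derive_kummer1F1_1 (b : C) (x : R) :
  not_nonpos_int b ->
  @is_derive C_AbsRing C_NormedModule (fun c => kummer1F1 1 c x) b
    (- (RtoC x * RtoC (exp x) * exp_cauchy 2 (- x) b)).
Proof.
  intros Hb.
  destruct (not_nonpos_int_separated b Hb) as [d [Hd Hn]].
  (* The radius is d / 2 because the remainder estimate asks for separation by twice the radius. *)
  apply (is_derive_quadratic_remainder _ _ _ (d / 2)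
    (Cmod (RtoC x * RtoC (exp x)) * (/ (d / 2) ^ 3 * exp (Rabs (- x))))%R); [lra|].
  intros h Hh.
  (* If b + h + n = 0, then |h| = |b + n| >= d, against |h| < d / 2. So the closed form is available
     at b + h too. *)
  assert (Hbh : not_nonpos_int (b + h)).
  { intros n E.
    assert (H := Hn n).
    replace (b + INR n) with (- h) in H
      by (replace (b + INR n) with (b + h + INR n - h) by ring; rewrite E; ring).
    rewrite Cmod_opp in H; lra. }
  rewrite (kummer1F1_1 _ x Hbh), (kummer1F1_1 _ x Hb).
  replace (_ - _ - _) with (RtoC x * RtoC (exp x) *
    (exp_cauchy 1 (- x) (b + h) - exp_cauchy 1 (- x) b + h * exp_cauchy 2 (- x) b))
    by ring.
  rewrite (Cmod_mult (RtoC x * RtoC (exp x))), Rmult_assoc.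
  apply Rmult_le_compat_l; [apply Cmod_ge_0|].
  apply exp_cauchy_quadratic_remainder; [lra | | exact Hh].
  intros n; specialize (Hn n); lra.
Qed.

(** * Identification of the 2F2 series *)

Lemma pFq_term_2F2_shift (b : C) (y : R) (n : nat) :
  not_nonpos_int b ->
  pFq_term (b :: b :: nil) (b + 1 :: b + 1 :: nil) y n =
  b ^ 2 * exp_cauchy_term 2 y b n.
Proof.
  intros Hb; unfold pFq_term, pochhammer_list, exp_cauchy_term; simpl fold_right.
  assert (Hb0 := Hb O); simpl in Hb0; rewrite Cplus_0_r in Hb0.
  assert (Hp := pochhammer_neq_0 b n Hb).
  assert (Hf : RtoC (INR (fact n)) <> 0)
    by (intros E; apply RtoC_inj in E; now apply (INR_fact_neq_0 n)).
  replace (pochhammer (b + 1) n) with (pochhammer b n * (b + INR n) / b)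
    by (rewrite <- pochhammer_shift; field; exact Hb0).
  rewrite RtoC_div, RtoC_pow by apply INR_fact_neq_0.
  field; repeat split; try assumption; apply Hb.
Qed.

Lemma hyp2F2_shift (b : C) (y : R) :
  not_nonpos_int b ->
  hyp2F2 b b (b + 1) (b + 1) y = b ^ 2 * exp_cauchy 2 y b.
Proof.
  intros Hb; apply CSeries_unique.
  eapply is_series_ext;
    [intros n; exact (eq_sym (pFq_term_2F2_shift b y n Hb))|].
  exact (@is_series_scal C_AbsRing C_NormedModule (b ^ 2) _ _
           (is_series_exp_cauchy 2 y b Hb)).
Qed.

Theorem corollary34 (b : C) (x : R)
  (hb : forall k : nat, b <> - RtoC (INR k)) :
  @ex_derive C_AbsRing C_NormedModule (fun c : C => kummer1F1 1 c x) b /\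
  kummerH1 1 b x =
    - (RtoC x * RtoC (exp x) / b ^ 2) *
      hyp2F2 b b (b + 1) (b + 1) (- RtoC x).
Proof.
  assert (Hb : not_nonpos_int b).
  { intros k E; apply (hb k).
    replace b with (b + INR k - INR k) by ring; rewrite E; ring. }
  assert (Hder := is_derive_kummer1F1_1 b x Hb).
  split; [exact (ex_intro _ _ Hder)|].
  eapply eq_trans; [exact (is_C_derive_unique _ _ _ Hder)|].
  rewrite <- RtoC_opp, (hyp2F2_shift b (- x) Hb).
  (* The case k = 0 says that b is nonzero, so the b^2 coming from the 2F2 cancels the
     denominator. *)
  assert (Hb0 := Hb O); simpl in Hb0; rewrite Cplus_0_r in Hb0.
  field; exact Hb0.
Qed.
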